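(* Let $k\ge 2$ be an integer and let $G$ be a graph. The following are equivalent: (i) $G$ admits a signing in which every $2k$-cycle is unbalanced; (ii) $\omega_{2k}$ is a coboundary, that is, $\omega_{2k}\in\operatorname{im}\delta^1$; (iii) $[\omega_{2k}]=0$ in $H^2(X_{2k}(G);\mathbb F_2)$; (iv) every cellular two-cycle of $X_{2k}(G)$ contains an even number of two-cells.
   Context: All graphs are finite and simple. A signing of $G$ is a map $\sigma:E(G)\to\{+1,-1\}$; the sign of a cycle is the product of its edge signs, and the cycle is unbalanced if its sign is $-1$. $\mathcal C_{2k}(G)$ is the set of simple $2k$-cycles of $G$. The $2k$-cycle complex $X_{2k}(G)$ is the two-dimensional CW complex with one-skeleton $G$ and with one two-cell $f_C$ attached along each $C\in\mathcal C_{2k}(G)$. All chains and cochains are cellular with coefficients in $\mathbb F_2$. Thus $\partial_2 f_C=\sum_{e\in E(C)}e$, and the coboundary map $\delta^1:C^1\to C^2$ is given by $(\delta^1x)(f_C)=\sum_{e\in E(C)}x(e)$. A cellular two-cycle is a two-chain $z$ (a set of two-cells) with $\partial_2z=0$. The two-cochain $\omega_{2k}$ is defined by $\omega_{2k}(f_C)=1$ for every $C\in\mathcal C_{2k}(G)$; since there are no three-cells it is a cocycle, and $[\omega_{2k}]$ is its class in $H^2(X_{2k}(G);\mathbb F_2)$. *)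

(* Defs.v *)
From HB Require Import structures.
From mathcomp Require Import all_boot all_order all_algebra.

Set Implicit Arguments.
Unset Strict Implicit.
Unset Printing Implicit Defensive.

Import GRing.Theory.
Local Open Scope ring_scope.
Local Open Scope quotient_scope.

Record sgraph := SGraph {
  vertex :> finType;
  adj : rel vertex;
  adj_sym : symmetric adj;
  adj_irrefl : irreflexive adj
}.

Definition edge_set (G : sgraph) : {set {set G}} :=
  [set [set p.1; p.2] | p : G * G & adj p.1 p.2].

Definition edge (G : sgraph) : finType := {e : {set G} | e \in edge_set G}.

(* A simple cycle, as a subgraph, is identified with its set of edges; a vertex
   sequence and its rotations and reversals give the same cycle. *)
Definition cycle_edges (G : sgraph) (c : seq G) : {set edge G} :=
  [set e : edge G | [exists x in c, val e == [set x; next c x]]].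

(* Meaningful for n >= 3 only: a closed walk x y x would count for n = 2. *)
Definition simple_cycles (G : sgraph) (n : nat) : {set {set edge G}} :=
  [set cycle_edges c | c : n.-tuple G & ucycleb (@adj G) c].

Definition is_signing (G : sgraph) (sigma : edge G -> int) : Prop :=
  forall e, sigma e = 1 \/ sigma e = -1.

Definition cycle_sign (G : sgraph) (sigma : edge G -> int) (C : {set edge G}) :=
  \prod_(e in C) sigma e.

Definition unbalanced (G : sgraph) (sigma : edge G -> int) (C : {set edge G}) :=
  cycle_sign sigma C = -1.

Section CycleComplex.
Variables (G : sgraph) (k : nat).

(* The two-cell f_C is represented by the pair of C and its membership proof,
   so val f_C is E(C). *)
Definition twocell : finType :=
  {C : {set edge G} | C \in simple_cycles G (2 * k)%N}.

(* The bases of cells identify both the chains and the cochains of each degree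
   with functions on the cells; ('F_2)^o is 'F_2 as a vector space over itself. *)
Definition chain1 : vectType 'F_2 := {ffun edge G -> ('F_2)^o}.
Definition chain2 : vectType 'F_2 := {ffun twocell -> ('F_2)^o}.
Definition cochain1 : vectType 'F_2 := {ffun edge G -> ('F_2)^o}.
Definition cochain2 : vectType 'F_2 := {ffun twocell -> ('F_2)^o}.
Definition cochain3 : vectType 'F_2 := {ffun void -> ('F_2)^o}.

Definition edge_chain (e : edge G) : chain1 := [ffun e' => (e' == e)%:R].

Definition boundary2_cell (f : twocell) : chain1 :=
  \sum_(e in val f) edge_chain e.

Definition boundary2_fun (z : chain2) : chain1 :=
  \sum_(f : twocell) z f *: boundary2_cell f.

Definition coboundary1_fun (x : cochain1) : cochain2 :=
  [ffun f : twocell => \sum_(e in val f) x e].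

Fact boundary2_is_linear : linear boundary2_fun.
Proof.
move=> a u v; rewrite /boundary2_fun scaler_sumr -big_split /=.
by apply: eq_bigr => f _; rewrite !ffunE scalerDl scalerA.
Qed.

Fact coboundary1_is_linear : linear coboundary1_fun.
Proof.
move=> a u v; apply/ffunP => f; rewrite !ffunE scaler_sumr -big_split /=.
by apply: eq_bigr => e _; rewrite !ffunE.
Qed.

HB.instance Definition _ :=
  GRing.isLinear.Build 'F_2 chain2 chain1 _ boundary2_fun boundary2_is_linear.
HB.instance Definition _ :=
  GRing.isLinear.Build 'F_2 cochain1 cochain2 _ coboundary1_fun
    coboundary1_is_linear.

Definition boundary2 : 'Hom(chain2, chain1) := linfun boundary2_fun.
Definition coboundary1 : 'Hom(cochain1, cochain2) := linfun coboundary1_fun.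
Definition coboundary2 : 'Hom(cochain2, cochain3) := 0.

Definition cocycles2 : {vspace cochain2} := lker coboundary2.

(* B^2 as a subspace of Z^2: the cocycles lying in the image of delta^1. *)
Definition coboundaries2 : {vspace subvs_of cocycles2} :=
  (linfun (vsval : subvs_of cocycles2 -> cochain2) @^-1: limg coboundary1)%VS.

Definition H2 := Quotient.quot coboundaries2.

Definition omega : cochain2 := [ffun _ => 1].

Fact omega_cocycle : omega \in cocycles2.
Proof. by rewrite memv_ker zero_lfunE. Qed.

Definition omega_class : H2 := \pi_H2 (Subvs omega_cocycle).

Definition twocells_of (z : chain2) : {set twocell} := [set f | z f != 0].

End CycleComplex.

Fact coboundary1E (G : sgraph) (k : nat) (x : cochain1 G) (f : twocell G k) :
  coboundary1 G k x f = \sum_(e in val f) x e.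
Proof. by rewrite lfunE ffunE. Qed.

Fact boundary2E (G : sgraph) (k : nat) (z : chain2 G k) :
  boundary2 G k z = \sum_(f : twocell G k) z f *: boundary2_cell f.
Proof. by rewrite lfunE. Qed.

(* Main.v *)
Require Import Defs.
From mathcomp Require Import all_boot all_order all_algebra.

Import GRing.Theory.
Local Open Scope ring_scope.

(** Writing each sign as $(-1)^{x(e)}$ turns a signing into a cochain $x$ over $\mathbb F_2$ and the
    sign of $C$ into $(-1)^{(\delta^1x)(f_C)}$, so a signing with every $2k$-cycle unbalanced is a
    solution of $\delta^1x=\omega_{2k}$ ([signing_coboundary]). Solvability is the vanishing of the
    class in $Z^2/B^2$ ([omega_class_eq0]). Finally $\delta^1$ is the transpose of $\partial_2$
    ([coboundary1_adjoint]), so its image is the annihilator of $\ker\partial_2$; since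
    $\omega_{2k}$ pairs with $z$ to the parity of the number of cells of $z$, it lies in the image
    exactly when every two-cycle is even. *)

Lemma natr_F2 (n : nat) : n%:R = (odd n)%:R :> 'F_2.
Proof. by apply/val_inj; rewrite /= !val_Fp_nat // !modn2; case: (odd n). Qed.

Lemma F2_natr_neq0 (a : 'F_2) : a = (a != 0)%:R.
Proof. by case: a => [[|[|n]] lt_n] //; apply/val_inj. Qed.

Lemma natr_F2_eq1 (n : nat) : (n%:R == 1 :> 'F_2) = odd n.
Proof. by rewrite natr_F2; case: (odd n). Qed.

Lemma signr_eqN1 (n : nat) : ((-1) ^+ n == -1 :> int) = odd n.
Proof. by rewrite -signr_odd; case: (odd n). Qed.

Section CycleComplexTheory.
Variables (G : sgraph) (k : nat).

Lemma boundary2_coef (z : chain2 G k) (e : edge G) :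
  boundary2 G k z e = \sum_(f : twocell G k | e \in val f) z f.
Proof.
rewrite boundary2E sum_ffunE [RHS]big_mkcond /=; apply: eq_bigr => f _.
rewrite ffunE /boundary2_cell sum_ffunE.
under eq_bigr do rewrite ffunE.
have [ef | nef] := boolP (e \in val f).
  rewrite (bigD1 e) //= eqxx big1 ?addr0; first by rewrite /GRing.scale /= mulr1.
  by move=> e' /andP[_ ne]; rewrite eq_sym (negbTE ne).
rewrite big1 ?scaler0 // => e' e'f.
by case: eqP => // ee'; rewrite ee' e'f in nef.
Qed.

(** Both sides sum [x e * z f] over the incident pairs of an edge and a two-cell. *)
Lemma coboundary1_adjoint (x : cochain1 G) (z : chain2 G k) :
  \sum_f (z f : 'F_2) * (coboundary1 G k x f : 'F_2)
    = \sum_e (x e : 'F_2) * (boundary2 G k z e : 'F_2).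
Proof.
under eq_bigr do rewrite coboundary1E mulr_sumr.
rewrite (exchange_big_dep predT) //=; apply: eq_bigr => e _.
by rewrite boundary2_coef mulr_sumr; apply: eq_bigr => f _; rewrite mulrC.
Qed.

(** The left side is the pairing of [z] with [omega]. *)
Lemma sum_chain2 (z : chain2 G k) :
  \sum_f (z f : 'F_2) = (#|twocells_of z|)%:R.
Proof.
rewrite -sum1_card natr_sum [RHS]big_mkcond /=; apply: eq_bigr => f _.
by rewrite inE [LHS]F2_natr_neq0; case: (_ != 0).
Qed.

Lemma omega_coboundaryP :
  reflect (exists x : cochain1 G, forall f : twocell G k, \sum_(e in val f) x e = 1)
          (omega G k \in limg (coboundary1 G k)).
Proof.
apply: (iffP memv_imgP) => [[x _ eq_x] | [x eq_x]]; exists x.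
- by move=> f; rewrite -coboundary1E -eq_x ffunE.
- exact: memvf.
- by apply/ffunP => f; rewrite coboundary1E eq_x ffunE.
Qed.

Lemma omega_class_eq0 :
  omega_class G k = 0 <-> omega G k \in limg (coboundary1 G k).
Proof.
have pi0 : (0 : H2 G k) = (\pi_(H2 G k) (0 : subvs_of (cocycles2 G k)))%qT.
  by rewrite piE.
have -> : (omega G k \in limg (coboundary1 G k))
        = (Subvs (omega_cocycle G k) - 0 \in coboundaries2 G k).
  by rewrite subr0 -memv_preim lfunE.
by rewrite /omega_class pi0 Quotient.idealrBE; split=> /eqP.
Qed.

Lemma signing_coboundary :
  (exists sigma : edge G -> int, is_signing sigma
    /\ forall C : {set edge G},
         C \in simple_cycles G (2 * k)%N -> unbalanced sigma C)
  <-> omega G k \in limg (coboundary1 G k).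
Proof.
split=> [[sigma [sg unb]] | /omega_coboundaryP[x eq_x]].
  (* The witness is the exponent of the sign; the parity of the exponent sum over a cycle decides
     the sign of the cycle. *)
  apply/omega_coboundaryP; exists [ffun e => (sigma e == -1)%:R] => -[C cC] /=.
  under eq_bigr do rewrite ffunE.
  rewrite -natr_sum; apply/eqP; rewrite natr_F2_eq1 -signr_eqN1 -prodrXr.
  apply/eqP; rewrite -[RHS](unb C cC); apply: eq_bigr => e _.
  by case: (sg e) => ->.
exists (fun e => (-1) ^+ (x e != 0)); split=> [e | C cC].
  by case: (x e != 0); [right | left].
rewrite /unbalanced /cycle_sign prodrXr; apply/eqP.
rewrite signr_eqN1 -natr_F2_eq1 natr_sum; apply/eqP.
by rewrite -[RHS](eq_x (Sub C cC)); apply: eq_bigr => e _; rewrite [RHS]F2_natr_neq0.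
Qed.

Lemma omega_coboundary_even_cycle (z : chain2 G k) :
  omega G k \in limg (coboundary1 G k) -> boundary2 G k z = 0 ->
  ~~ odd #|twocells_of z|.
Proof.
move=> /memv_imgP[x _ eq_x] bz0.
rewrite -natr_F2_eq1 -sum_chain2.
have := coboundary1_adjoint x z; rewrite -eq_x bz0.
under eq_bigr do rewrite ffunE mulr1.
by move=> ->; rewrite big1 // => e _; rewrite ffunE mulr0.
Qed.

(* If the all-ones row is outside the row space of the incidence matrix M, some
   column of cokermx M is a two-cycle on which it does not vanish. *)
Lemma even_cycles_omega_coboundary :
  (forall z : chain2 G k, boundary2 G k z = 0 -> ~~ odd #|twocells_of z|) ->
  omega G k \in limg (coboundary1 G k).
Proof.
move=> even_cycles.
pose M : 'M['F_2]_(#|edge G|, #|twocell G k|) :=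
  \matrix_(i, j) (enum_val i \in val (enum_val j : twocell G k))%:R.
have : ((const_mx 1 : 'rV['F_2]_#|twocell G k|) <= M)%MS.
  rewrite submxE; apply/eqP/rowP => j; rewrite [RHS]mxE.
  (* Membership in the row space means being killed by [cokermx M]; this is tested on its column
     [j], read as a two-chain. *)
  pose z : chain2 G k := [ffun f => cokermx M (enum_rank f) j].
  have bz0 : boundary2 G k z = 0.
    apply/ffunP => e; rewrite boundary2_coef [RHS]ffunE.
    have /matrixP/(_ (enum_rank e) j) := mulmx_coker M; rewrite !mxE => col0.
    rewrite -[RHS]col0.
    rewrite (reindex _ (onW_bij _ (enum_val_bij (twocell G k)))) /= big_mkcond.
    apply: eq_bigr => i _; rewrite mxE enum_rankK ffunE enum_valK.
    by case: ifP => _; rewrite ?mul1r ?mul0r.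
  (* Entry [j] of the all-ones row times [cokermx M] is the coefficient sum of [z], hence its
     parity. *)
  transitivity (\sum_f (z f : 'F_2)).
    rewrite mxE (reindex _ (onW_bij _ (enum_val_bij (twocell G k)))) /=.
    by apply: eq_bigr => i _; rewrite mxE mul1r ffunE enum_valK.
  have := even_cycles z bz0; rewrite -natr_F2_eq1 -sum_chain2 => ne1.
  by apply/eqP; apply: contraNT ne1 => ne0; rewrite [X in X == 1]F2_natr_neq0 ne0.
case/submxP => y eq_y; apply/omega_coboundaryP.
(* The coefficients expressing the all-ones row through the rows of [M], one for each edge, form the
   required cochain. *)
exists [ffun e => y 0 (enum_rank e)] => f.
have /rowP/(_ (enum_rank f)) := eq_y; rewrite !mxE => ->.
rewrite (reindex _ (onW_bij _ (enum_val_bij (edge G)))) /= big_mkcond.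
apply: eq_bigr => i _; rewrite mxE enum_rankK ffunE enum_valK.
by case: ifP => _; rewrite ?mulr1 ?mulr0.
Qed.

End CycleComplexTheory.

Theorem theorem2p3 (k : nat) (hk : (2 <= k)%N) (G : sgraph) :
  [<-> exists sigma : edge G -> int,
         is_signing sigma
         /\ forall C : {set edge G},
              C \in simple_cycles G (2 * k)%N -> unbalanced sigma C;
       omega G k \in limg (coboundary1 G k);
       omega_class G k = 0;
       forall z : chain2 G k,
         boundary2 G k z = 0 -> ~~ odd #|twocells_of z| ].
Proof.
tfae.
- by move/signing_coboundary.
- by move/omega_class_eq0.
- by move/omega_class_eq0 => h z; apply: omega_coboundary_even_cycle.
- by move/even_cycles_omega_coboundary/signing_coboundary.
Qed.
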